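(* Let $a,b\in\mathbb{R}$, $\beta\ge 0$, $\alpha\ge 0$, and let $u=u(x,t)$ be a smooth positive solution, for $x\in\mathbb{T}$, $t>0$, to $$\partial_t u=-J_x,\qquad J=u^\beta u_{xxx}+a\,u^{\beta-1}u_{xx}u_x+b\,u^{\beta-2}u_x^3 .$$ Set $S_\alpha(t)=\int_{\mathbb{T}}s_\alpha(u(x,t))\,dx$ and $$K(\alpha,\beta)=-2\alpha^2+(3a-4\beta+9)\alpha-2\beta^2+(3a+9)\beta-9(a+b+1).$$ (i) If $K(\alpha,\beta)\ge 0$, then $S_\alpha$ is a Lyapunov functional, i.e. $dS_\alpha/dt\le 0$ for all $t>0$. (ii) If $K(\alpha,\beta)>0$, then there exists a constant $c(\alpha,\beta)>0$ such that for all $t>0$, $$\frac{dS_\alpha}{dt}+c(\alpha,\beta)\int_{\mathbb{T}}u^{\alpha+\beta}\Big(u^{2(1-\alpha)}\big((u^{\alpha-1})_{xx}\big)^2+u^{4(1-\alpha)}\big((u^{\alpha-1})_x\big)^4\Big)dx\le 0,$$ and there exists another constant $C(\alpha,\beta)>0$ such that for all $t>0$, $$\frac{dS_\alpha}{dt}+C(\alpha,\beta)\int_{\mathbb{T}}u^{\alpha+\beta}\big(u^{-2}u_{xx}^2+u^{-4}u_x^4\big)dx\le 0 .$$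
   Context: $\mathbb{T}=\mathbb{R}/\mathbb{Z}$ is the one-dimensional torus; subscripts $x$ denote spatial derivatives. The entropy densities are, for $u>0$: $s_\alpha(u)=\frac{u^\alpha}{\alpha(\alpha-1)}$ for $\alpha>0$, $\alpha\ne 1$; $s_0(u)=-\log u$; $s_1(u)=u(\log u-1)$. The constants $c(\alpha,\beta)$, $C(\alpha,\beta)$ depend only on $\alpha,\beta$ (and the fixed coefficients $a,b$), not on $u$ or $t$. *)

(* Defs.v *)
From Stdlib Require Import Reals.
From Coquelicot Require Import Coquelicot.
Open Scope R_scope.

(** Functions on the torus R/Z are represented as 1-periodic functions on R and
    integrated over [0, 1].  A function of space and time is [u : R -> R -> R],
    written [u x t]; only its values for [t > 0] matter. *)

Definition dx (u : R -> R -> R) (x t : R) : R := Derive (fun y => u y t) x.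
Definition dt (u : R -> R -> R) (x t : R) : R := Derive (fun s => u x s) t.

Definition torus_int (f : R -> R) : R := RInt f 0 1.

(** Joint C^k regularity on the open set {(x, t) | t > 0}. *)
Fixpoint Ck (k : nat) (u : R -> R -> R) : Prop :=
  (forall x t, 0 < t -> continuity_2d_pt u x t) /\
  match k with
  | O => True
  | S k' =>
      (forall x t, 0 < t ->
        ex_derive (fun y => u y t) x /\ ex_derive (fun s => u x s) t) /\
      Ck k' (dx u) /\ Ck k' (dt u)
  end.

Definition smooth (u : R -> R -> R) : Prop := forall k, Ck k u.

(** [Rpower r p = exp (p * ln r)] is the real power for [r > 0], the only case
    in which it is used below. *)
Definition flux (a b beta : R) (u : R -> R -> R) (x t : R) : R :=
  Rpower (u x t) beta * dx (dx (dx u)) x t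
  + a * Rpower (u x t) (beta - 1) * dx (dx u) x t * dx u x t
  + b * Rpower (u x t) (beta - 2) * dx u x t ^ 3.

Record smooth_positive_solution (a b beta : R) (u : R -> R -> R) : Prop := {
  sol_periodic : forall x t, 0 < t -> u (x + 1) t = u x t;
  sol_smooth : smooth u;
  sol_positive : forall x t, 0 < t -> 0 < u x t;
  sol_pde : forall x t, 0 < t -> dt u x t = - dx (flux a b beta u) x t
}.

Definition entropy_density (alpha r : R) : R :=
  if Req_EM_T alpha 0 then - ln r
  else if Req_EM_T alpha 1 then r * (ln r - 1)
  else Rpower r alpha / (alpha * (alpha - 1)).

Definition entropy (alpha : R) (u : R -> R -> R) (t : R) : R :=
  torus_int (fun x => entropy_density alpha (u x t)).

Definition K (a b alpha beta : R) : R :=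
  - 2 * alpha ^ 2 + (3 * a - 4 * beta + 9) * alpha
  - 2 * beta ^ 2 + (3 * a + 9) * beta - 9 * (a + b + 1).

Definition dissipation1 (alpha beta : R) (u : R -> R -> R) (t : R) : R :=
  let v := fun y s => Rpower (u y s) (alpha - 1) in
  torus_int (fun x =>
    Rpower (u x t) (alpha + beta) *
    (Rpower (u x t) (2 * (1 - alpha)) * dx (dx v) x t ^ 2
     + Rpower (u x t) (4 * (1 - alpha)) * dx v x t ^ 4)).

Definition dissipation2 (alpha beta : R) (u : R -> R -> R) (t : R) : R :=
  torus_int (fun x =>
    Rpower (u x t) (alpha + beta) *
    (Rpower (u x t) (-2) * dx (dx u) x t ^ 2
     + Rpower (u x t) (-4) * dx u x t ^ 4)).

(* Main.v *)
Require Import Defs.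
From Stdlib Require Import Reals Lra.
From Coquelicot Require Import Coquelicot.
Open Scope R_scope.

(** Put [y = u_x / u], [z = u_xx / u], [g = alpha + beta].  Since
    [s_alpha'' (u) = u^(alpha-2)], integrating by parts turns [dS_alpha/dt] into
    the integral of [u^(alpha-2) u_x J].  Adding to it a suitable multiple of the
    null integrals of [(u^g y z)_x] and [(u^g y^3)_x] gives
    [dS_alpha/dt = - int u^g ((z - (1 - g/3) y^2)^2 + K/9 y^4)].
    The multiple of [(u^g y^3)_x] is the one which minimises the discriminant of
    the resulting quadratic form in [(z, y^2)]; the minimum is [-4K/9].
    For [K > 0] the form is definite, hence dominates both dissipations. *)

(** * Real powers and the derivatives of the entropy densities *)

(** Turns shifted exponents such as [beta - 2] into division by a natural power, a form that [field]
    can handle. *)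
Lemma Rpower_minus_INR (r p : R) (n : nat) :
  0 < r -> Rpower r (p - INR n) = Rpower r p / r ^ n.
Proof.
  intros hr. unfold Rminus. rewrite Rpower_plus, Rpower_Ropp, Rpower_pow by exact hr.
  reflexivity.
Qed.

Lemma is_derive_Rpower (r p : R) :
  0 < r -> is_derive (fun s => Rpower s p) r (p * Rpower r (p - 1)).
Proof. intros hr. apply is_derive_Reals, derivable_pt_lim_power, hr. Qed.

(** At [alpha = 0] the second branch is [- / r], the derivative of [- ln r], so only [alpha = 1] is
    singled out. *)
Definition entropy_density' (alpha r : R) : R :=
  if Req_EM_T alpha 1 then ln r else Rpower r (alpha - 1) / (alpha - 1).

Lemma is_derive_entropy_density (alpha r : R) :
  0 < r -> is_derive (entropy_density alpha) r (entropy_density' alpha r).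
Proof.
  intros hr. unfold entropy_density, entropy_density'.
  destruct (Req_EM_T alpha 0) as [h0 | h0].
  - destruct (Req_EM_T alpha 1) as [h1 | h1]; [lra |].
    subst alpha.
    replace (Rpower r (0 - 1)) with (/ r).
    2: { change 1 with (INR 1). rewrite Rpower_minus_INR by exact hr.
         rewrite Rpower_O by exact hr. simpl. field. lra. }
    auto_derive; [exact hr | field; lra].
  - destruct (Req_EM_T alpha 1) as [h1 | h1].
    + auto_derive; [exact hr | field; lra].
    + evar_last.
      { apply (is_derive_scal_l (fun s => Rpower s alpha) r (alpha * Rpower r (alpha - 1)) (/ (alpha * (alpha - 1)))).
        apply is_derive_Rpower, hr. }
      unfold scal; simpl; unfold mult; simpl. field. lra.
Qed.

(** One formula serves all [alpha], so the case distinction between the entropies ends here. *)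
Lemma is_derive_entropy_density' (alpha r : R) :
  0 < r -> is_derive (entropy_density' alpha) r (Rpower r alpha / r ^ 2).
Proof.
  intros hr. unfold entropy_density'.
  destruct (Req_EM_T alpha 1) as [h1 | h1].
  - subst alpha. rewrite Rpower_1 by exact hr.
    auto_derive; [exact hr | field; lra].
  - evar_last.
    { apply (is_derive_scal_l (fun s => Rpower s (alpha - 1)) r
               ((alpha - 1) * Rpower r (alpha - 1 - 1)) (/ (alpha - 1))).
      apply is_derive_Rpower, hr. }
    replace (alpha - 1 - 1) with (alpha - INR 2) by (simpl; ring).
    rewrite Rpower_minus_INR by exact hr.
    unfold scal; simpl; unfold mult; simpl. field. lra.
Qed.

(** * Integration over one period *)

(** The fundamental theorem of calculus; it stands for every integration by parts in the
    argument. *)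
Lemma RInt_derive_periodic (G g : R -> R) :
  (forall x, is_derive G x (g x)) -> (forall x, continuous g x) ->
  G 1 = G 0 -> is_RInt g 0 1 0.
Proof.
  intros hd hc hG. evar_last.
  { apply (is_RInt_derive G g); auto. }
  rewrite hG. apply (minus_eq_zero (G 0)).
Qed.

Lemma ex_RInt_01 (f : R -> R) : (forall x, continuous f x) -> ex_RInt f 0 1.
Proof. intros hf. apply (ex_RInt_continuous (V := R_CompleteNormedModule)). auto. Qed.

(** Reduces integral estimates to pointwise ones. [Q] will be the entropy production, whose negative
    integral is the time derivative of the entropy. *)
Lemma torus_int_dominate (c : R) (D Q : R -> R) :
  (forall x, continuous D x) -> (forall x, continuous Q x) ->
  (forall x, c * D x <= Q x) -> - torus_int Q + c * torus_int D <= 0.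
Proof.
  intros hD hQ h. unfold torus_int.
  assert (RInt (fun x => c * D x) 0 1 <= RInt Q 0 1).
  { apply RInt_le; [lra | | apply ex_RInt_01, hQ | auto].
    apply (ex_RInt_scal D), ex_RInt_01, hD. }
  rewrite (RInt_scal D) in H by apply ex_RInt_01, hD.
  unfold scal in H; simpl in H; unfold mult in H; simpl in H. lra.
Qed.

(** * Smooth functions of space and time *)

Lemma smooth_dx (u : R -> R -> R) : smooth u -> smooth (dx u).
Proof. intros h k. apply (h (S k)). Qed.

Lemma smooth_dt (u : R -> R -> R) : smooth u -> smooth (dt u).
Proof. intros h k. apply (h (S k)). Qed.

Lemma smooth_continuity_2d (u : R -> R -> R) (x t : R) :
  smooth u -> 0 < t -> continuity_2d_pt u x t.
Proof. intros h ht. apply (h O), ht. Qed.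

Lemma continuity_2d_pt_section (u : R -> R -> R) (x t : R) :
  continuity_2d_pt u x t -> continuous (fun y => u y t) x.
Proof.
  intros h. apply continuity_pt_filterlim, continuity_pt_locally. intros eps.
  destruct (h eps) as [d hd]. exists d. intros y hy. apply hd; [exact hy |].
  rewrite Rminus_diag, Rabs_R0. apply cond_pos.
Qed.

Lemma continuity_2d_pt_swap (u : R -> R -> R) (x t : R) :
  continuity_2d_pt u x t -> continuity_2d_pt (fun s y => u y s) t x.
Proof. intros h eps. destruct (h eps) as [d hd]. exists d. auto. Qed.

Lemma smooth_is_derive_x (u : R -> R -> R) (x t : R) :
  smooth u -> 0 < t -> is_derive (fun y => u y t) x (dx u x t).
Proof. intros h ht. apply Derive_correct, (h 1%nat), ht. Qed.

Lemma smooth_is_derive_t (u : R -> R -> R) (x t : R) :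
  smooth u -> 0 < t -> is_derive (fun s => u x s) t (dt u x t).
Proof. intros h ht. apply Derive_correct, (h 1%nat), ht. Qed.

(** The difference quotients at [x + 1] and at [x] agree term by term, hence so do their limits. *)
Lemma dx_periodic (u : R -> R -> R) (t : R) :
  (forall x, u (x + 1) t = u x t) -> forall x, dx u (x + 1) t = dx u x t.
Proof.
  intros h x. unfold dx, Derive. f_equal. apply Lim_ext. intros e.
  rewrite <- (h x), <- (h (x + e)). do 3 f_equal. ring.
Qed.

(** * The pointwise entropy identity *)

(** The arguments [r], [p], [q] stand for the values of [u], [u_x], [u_xx]. *)
Definition entropy_production (a b alpha beta r p q : R) : R :=
  Rpower r (alpha + beta) *
  ((q / r - (1 - (alpha + beta) / 3) * (p / r) ^ 2) ^ 2
   + K a b alpha beta / 9 * (p / r) ^ 4).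

(** The derivative of [u^g y z] cancels the third derivative in [u^(alpha-2) u_x J]. The coefficient
    of [y^3] is the minimiser of the discriminant; it turns the cross term of the production into
    [- 2 (1 - g/3) z y^2]. *)
Definition null_flux (a alpha beta r p q : R) : R :=
  Rpower r (alpha + beta) *
  (p / r * (q / r) - (alpha + beta - 3 * a) / 9 * (p / r) ^ 3).

(** By the chain rule the first product contributes [s'(f) J'] and [s''(f) f1 J]. The latter minus
    the derivative of the null flux is an algebraic expression in [y] and [z], equal to minus the
    production. Since [J'] is never expanded, no fourth derivative enters. *)
Lemma entropy_flux_identity (a b alpha beta x J' : R) (f f1 f2 f3 J : R -> R) :
  0 < f x ->
  is_derive f x (f1 x) -> is_derive f1 x (f2 x) -> is_derive f2 x (f3 x) ->
  is_derive J x J' ->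
  J x = Rpower (f x) beta * f3 x + a * Rpower (f x) (beta - 1) * f2 x * f1 x
        + b * Rpower (f x) (beta - 2) * f1 x ^ 3 ->
  is_derive
    (fun y => entropy_density' alpha (f y) * J y
              - null_flux a alpha beta (f y) (f1 y) (f2 y)) x
    (entropy_density' alpha (f x) * J'
     - entropy_production a b alpha beta (f x) (f1 x) (f2 x)).
Proof.
  intros hf h0 h1 h2 hJ eJ.
  assert (hs : is_derive (fun y => entropy_density' alpha (f y)) x
                 (f1 x * (Rpower (f x) alpha / f x ^ 2))).
  { apply (is_derive_comp (entropy_density' alpha) f); [| exact h0].
    apply is_derive_entropy_density', hf. }
  (* Product rule with [(f^g)' = g y f^g], [y' = z - y^2] and [z' = f3 / f - z y]. *)
  assert (hN : is_derive (fun y => null_flux a alpha beta (f y) (f1 y) (f2 y)) x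
    (Rpower (f x) (alpha + beta) *
     ((alpha + beta) * (f1 x / f x) *
        (f1 x / f x * (f2 x / f x) - (alpha + beta - 3 * a) / 9 * (f1 x / f x) ^ 3)
      + (f2 x / f x - (f1 x / f x) ^ 2) * (f2 x / f x)
      + f1 x / f x * (f3 x / f x - f2 x / f x * (f1 x / f x))
      - (alpha + beta - 3 * a) / 3 * (f1 x / f x) ^ 2
        * (f2 x / f x - (f1 x / f x) ^ 2)))).
  { unfold null_flux, Rpower.
    auto_derive.
    - repeat split; try (eexists; eassumption); try lra.
    - replace (Derive (fun y => f y) x) with (f1 x) by (symmetry; apply is_derive_unique, h0).
      replace (Derive (fun y => f1 y) x) with (f2 x) by (symmetry; apply is_derive_unique, h1).
      replace (Derive (fun y => f2 y) x) with (f3 x) by (symmetry; apply is_derive_unique, h2).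
      field. lra. }
  evar_last.
  { apply (is_derive_minus (V := R_NormedModule)); [| exact hN].
    apply (is_derive_mult _ _ _ _ _ hs hJ). intros; apply Rmult_comm. }
  unfold minus, plus, opp, mult; simpl.
  rewrite eJ.
  (* All exponents are reduced until [Rpower (f x) alpha] and [Rpower (f x) beta] are the only real
     powers, atoms for [field]. *)
  replace (beta - 1) with (beta - INR 1) by reflexivity.
  replace (beta - 2) with (beta - INR 2) by (simpl; ring).
  rewrite !Rpower_minus_INR by exact hf.
  unfold entropy_production, K. rewrite Rpower_plus. simpl. field. lra.
Qed.

(** * Time derivative of the entropy along a solution *)

Section Solution.

Context {a b alpha beta : R} {u : R -> R -> R}.
Hypothesis sol : smooth_positive_solution a b beta u.

Let u_smooth : smooth u := sol_smooth _ _ _ _ sol.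
Let u_pos := sol_positive _ _ _ _ sol.

Definition production (x t : R) : R :=
  entropy_production a b alpha beta (u x t) (dx u x t) (dx (dx u) x t).

Lemma ex_derive_dx_iter (t : R) : 0 < t ->
  (forall x, ex_derive (fun y => u y t) x)
  /\ (forall x, ex_derive (fun y => dx u y t) x)
  /\ (forall x, ex_derive (fun y => dx (dx u) y t) x)
  /\ (forall x, ex_derive (fun y => dx (dx (dx u)) y t) x).
Proof.
  intros ht. repeat split; intros x; eexists; apply smooth_is_derive_x;
    repeat apply smooth_dx; auto.
Qed.

Lemma production_continuous (t x : R) : 0 < t -> continuous (fun y => production y t) x.
Proof.
  intros ht. destruct (ex_derive_dx_iter t ht) as (h0 & h1 & h2 & _).
  pose proof (u_pos x t ht).
  apply (ex_derive_continuous (fun y => production y t)).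
  unfold production, entropy_production, Rpower. auto_derive.
  repeat split; auto; lra.
Qed.

Lemma flux_is_derive (x t : R) : 0 < t ->
  is_derive (fun y => flux a b beta u y t) x (- dt u x t).
Proof.
  intros ht. rewrite (sol_pde _ _ _ _ sol x t ht), Ropp_involutive.
  apply Derive_correct.
  destruct (ex_derive_dx_iter t ht) as (h0 & h1 & h2 & h3).
  pose proof (u_pos x t ht).
  unfold flux, Rpower. auto_derive. repeat split; auto; lra.
Qed.

(** Differentiation under the integral sign requires joint continuity of the time derivative of the
    density. *)
Lemma integrand_continuity_2d (x t : R) : 0 < t ->
  continuity_2d_pt (fun y s => entropy_density' alpha (u y s) * dt u y s) x t.
Proof.
  intros ht. apply continuity_2d_pt_mult.
  - apply (continuity_1d_2d_pt_comp (entropy_density' alpha)).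
    + apply continuity_pt_filterlim, (ex_derive_continuous (entropy_density' alpha)).
      eexists. apply is_derive_entropy_density', u_pos, ht.
    + apply smooth_continuity_2d; auto.
  - apply smooth_continuity_2d; auto. apply smooth_dt; auto.
Qed.

Lemma is_derive_density_t (x t : R) : 0 < t ->
  is_derive (fun s => entropy_density alpha (u x s)) t
    (entropy_density' alpha (u x t) * dt u x t).
Proof.
  intros ht. rewrite Rmult_comm.
  apply (is_derive_comp (entropy_density alpha) (fun s => u x s)).
  - apply is_derive_entropy_density, u_pos, ht.
  - apply smooth_is_derive_t; auto.
Qed.

Lemma RInt_density_t (t : R) : 0 < t ->
  RInt (fun x => entropy_density' alpha (u x t) * dt u x t) 0 1
  = - torus_int (fun x => production x t).
Proof.
  intros ht.
  assert (hP := fun x => production_continuous t x ht).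
  assert (hI := fun x => continuity_2d_pt_section _ _ _ (integrand_continuity_2d x t ht)).
  (* As [J_x = - u_t], this integrand is the [x]-derivative of [s'(u) J] minus the null flux. *)
  assert (h0 : is_RInt (fun x => entropy_density' alpha (u x t) * - dt u x t
                                 - production x t) 0 1 0).
  { eapply RInt_derive_periodic.
    - intros x.
      apply (entropy_flux_identity a b alpha beta x (- dt u x t) (fun y => u y t)
        (fun y => dx u y t) (fun y => dx (dx u) y t) (fun y => dx (dx (dx u)) y t)
        (fun y => flux a b beta u y t)); try (apply smooth_is_derive_x; auto;
        repeat apply smooth_dx; auto).
      + apply u_pos, ht.
      + apply flux_is_derive, ht.
      + reflexivity.
    - intros x. apply (continuous_minus (V := R_NormedModule)); [| apply hP].
      apply (continuous_ext (fun y => opp (entropy_density' alpha (u y t) * dt u y t))).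
      { intros y. unfold opp; simpl. ring. }
      apply (continuous_opp (V := R_NormedModule)), hI.
    (* The flux involves [x]-derivatives up to order three, so periodicity is carried that far to
       match the end values. *)
    - assert (p0 := fun x => sol_periodic _ _ _ _ sol x t ht).
      assert (p1 := dx_periodic _ _ p0).
      assert (p2 := dx_periodic _ _ p1).
      assert (p3 := dx_periodic _ _ p2).
      specialize (p0 0); specialize (p1 0); specialize (p2 0); specialize (p3 0).
      rewrite Rplus_0_l in p0, p1, p2, p3.
      unfold flux. cbv beta. rewrite p0, p1, p2, p3. reflexivity. }
  apply is_RInt_unique. evar_last.
  (* The integrand [s'(u) u_t] is minus the production minus the integrand of [h0]. *)
  { eapply is_RInt_ext.
    2: { apply (is_RInt_minus (V := R_NormedModule)); [| exact h0].
         apply (is_RInt_opp (V := R_NormedModule)).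
         apply (RInt_correct (V := R_CompleteNormedModule)), ex_RInt_01, hP. }
    intros x _. unfold minus, plus, opp; simpl. ring. }
  unfold minus, plus, opp, torus_int; simpl. ring.
Qed.

Lemma is_derive_entropy (t : R) : 0 < t ->
  is_derive (entropy alpha u) t (- torus_int (fun x => production x t)).
Proof.
  intros ht. rewrite <- (RInt_density_t t ht).
  rewrite (RInt_ext _ (fun x => Derive (fun s => entropy_density alpha (u x s)) t)).
  2: { intros x _. symmetry. apply is_derive_unique, is_derive_density_t, ht. }
  assert (hloc : locally t (fun s => 0 < s)).
  { apply (open_gt 0 t ht). }
  apply (is_derive_RInt_param (fun s x => entropy_density alpha (u x s))).
  - revert hloc. apply filter_imp. intros s hs x _. eexists. apply is_derive_density_t, hs.
  - intros x _.
    apply (continuity_2d_pt_ext_loc (fun s y => entropy_density' alpha (u y s) * dt u y s)).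
    (* Radius [t] keeps [s] positive, where the equation holds. *)
    + exists (mkposreal t ht). intros s y hs _. simpl in hs.
      symmetry. apply is_derive_unique, is_derive_density_t.
      apply Rabs_def2 in hs. lra.
    + apply (continuity_2d_pt_swap (fun y s => entropy_density' alpha (u y s) * dt u y s)).
      apply integrand_continuity_2d, ht.
  - revert hloc. apply filter_imp. intros s hs. apply ex_RInt_01. intros x.
    apply (continuous_comp (fun y => u y s) (entropy_density alpha)).
    + apply continuity_2d_pt_section, smooth_continuity_2d; auto.
    + apply (ex_derive_continuous (entropy_density alpha)).
      eexists. apply is_derive_entropy_density, u_pos, hs.
Qed.

(** All three claims of the theorem are instances; only the pointwise bound on [D] differs. *)
Lemma entropy_dissipation (c t : R) (D : R -> R) : 0 < t ->
  (forall x, continuous D x) -> (forall x, c * D x <= production x t) ->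
  ex_derive (entropy alpha u) t /\ Derive (entropy alpha u) t + c * torus_int D <= 0.
Proof.
  intros ht hD h. pose proof (is_derive_entropy t ht) as hS.
  split; [eexists; exact hS |]. rewrite (is_derive_unique _ _ _ hS).
  apply torus_int_dominate; auto. intros x. apply production_continuous, ht.
Qed.

(** * Spatial derivatives of powers of the solution *)

Lemma dx_Rpower (p x t : R) : 0 < t ->
  dx (fun y s => Rpower (u y s) p) x t = p * (Rpower (u x t) p / u x t) * dx u x t.
Proof.
  intros ht. apply is_derive_unique. rewrite Rmult_comm.
  apply (is_derive_comp (fun r => Rpower r p) (fun y => u y t)).
  - replace (Rpower (u x t) p / u x t) with (Rpower (u x t) (p - 1)).
    + apply is_derive_Rpower, u_pos, ht.
    + change 1 with (INR 1). rewrite Rpower_minus_INR by apply u_pos, ht.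
      simpl. rewrite Rmult_1_r. reflexivity.
  - apply smooth_is_derive_x; auto.
Qed.

Lemma dxx_Rpower (p x t : R) : 0 < t ->
  dx (dx (fun y s => Rpower (u y s) p)) x t
  = p * Rpower (u x t) p *
    (dx (dx u) x t / u x t + (p - 1) * (dx u x t / u x t) ^ 2).
Proof.
  intros ht. unfold dx at 1.
  rewrite (Derive_ext _ (fun y => p * (Rpower (u y t) p / u y t) * dx u y t)).
  2: { intros y. apply dx_Rpower, ht. }
  apply is_derive_unique.
  destruct (ex_derive_dx_iter t ht) as (h0 & h1 & _).
  pose proof (u_pos x t ht).
  unfold Rpower. auto_derive.
  - repeat split; auto; lra.
  - unfold dx. field. lra.
Qed.

End Solution.

(** * Dissipation densities and their pointwise comparison with the production *)

(** For [v = u^(alpha-1)] one has [v_x / v = (alpha-1) y] and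
    [v_xx / v = (alpha-1) (z + (alpha-2) y^2)]; the weights of the dissipation are [v^(-2)] and
    [v^(-4)]. *)
Definition dissipation1_density (alpha beta r p q : R) : R :=
  Rpower r (alpha + beta) *
  ((alpha - 1) ^ 2 * (q / r + (alpha - 2) * (p / r) ^ 2) ^ 2
   + (alpha - 1) ^ 4 * (p / r) ^ 4).

Definition dissipation2_density (alpha beta r p q : R) : R :=
  Rpower r (alpha + beta) * ((q / r) ^ 2 + (p / r) ^ 4).

Lemma dissipation1E (a b alpha beta : R) (u : R -> R -> R) (t : R) :
  smooth_positive_solution a b beta u -> 0 < t ->
  dissipation1 alpha beta u t
  = torus_int (fun x => dissipation1_density alpha beta (u x t) (dx u x t) (dx (dx u) x t)).
Proof.
  intros sol ht. unfold dissipation1, torus_int. apply RInt_ext. intros x _.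
  cbv zeta. rewrite (dx_Rpower sol), (dxx_Rpower sol) by exact ht.
  pose proof (sol_positive _ _ _ _ sol x t ht).
  assert (0 < Rpower (u x t) (alpha - 1)) by apply exp_pos.
  (* The weights become inverse natural powers of [Rpower (u x t) (alpha - 1)], which cancel against
     the derivatives. *)
  replace (2 * (1 - alpha)) with (- ((alpha - 1) * INR 2)) by (simpl; ring).
  replace (4 * (1 - alpha)) with (- ((alpha - 1) * INR 4)) by (simpl; ring).
  rewrite !Rpower_Ropp, <- !Rpower_mult, !Rpower_pow by apply exp_pos.
  unfold dissipation1_density. apply Rminus_diag_uniq. field. lra.
Qed.

Lemma dissipation2E (a b alpha beta : R) (u : R -> R -> R) (t : R) :
  smooth_positive_solution a b beta u -> 0 < t ->
  dissipation2 alpha beta u t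
  = torus_int (fun x => dissipation2_density alpha beta (u x t) (dx u x t) (dx (dx u) x t)).
Proof.
  intros sol ht. unfold dissipation2, torus_int. apply RInt_ext. intros x _.
  pose proof (sol_positive _ _ _ _ sol x t ht).
  replace (-2) with (- INR 2) by (simpl; ring).
  replace (-4) with (- INR 4) by (simpl; ring).
  rewrite !Rpower_Ropp, !Rpower_pow by assumption.
  unfold dissipation2_density. apply Rminus_diag_uniq. field. lra.
Qed.

Lemma dissipation2_density_le (a b alpha beta : R) :
  0 < K a b alpha beta ->
  exists c : R, 0 < c /\ forall r p q,
    c * dissipation2_density alpha beta r p q <= entropy_production a b alpha beta r p q.
Proof.
  intros hK. set (k := K a b alpha beta / 9).
  assert (hk : 0 < k) by (unfold k; lra).
  set (m := 1 - (alpha + beta) / 3).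
  assert (hm : 0 <= m ^ 2) by apply pow2_ge_0.
  assert (hM : 0 < 2 * k + 2 * m ^ 2 + 1) by lra.
  (* [k (z^2 + y^4)] is at most [2 k (z - m y^2)^2 + (2 m^2 + 1) k y^4], and the denominator exceeds
     neither less than [2 k] nor less than [2 m^2 + 1]: it is their sum. *)
  exists (k / (2 * k + 2 * m ^ 2 + 1)). split; [apply Rdiv_lt_0_compat; lra |].
  intros r p q. unfold dissipation2_density, entropy_production. fold k m.
  assert (0 < Rpower r (alpha + beta)) by apply exp_pos.
  set (z := q / r). set (y := p / r).
  enough (k / (2 * k + 2 * m ^ 2 + 1) * (z ^ 2 + y ^ 4)
          <= (z - m * y ^ 2) ^ 2 + k * y ^ 4) by nra.
  apply (Rmult_le_reg_l _ _ _ hM). field_simplify; [| lra].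
  (* [z^2 <= 2 (z - m y^2)^2 + 2 m^2 y^4] *)
  pose proof (pow2_ge_0 (z - 2 * m * y ^ 2)) as h1.
  pose proof (pow2_ge_0 (z - m * y ^ 2)) as h2.
  pose proof (pow2_ge_0 (y ^ 2)) as h3.
  (* The difference of the two sides is the first of these terms plus the second plus twice the
     third. *)
  assert (0 <= k * (z - 2 * m * y ^ 2) ^ 2) by (apply Rmult_le_pos; lra).
  assert (0 <= (2 * m ^ 2 + 1) * (z - m * y ^ 2) ^ 2) by (apply Rmult_le_pos; lra).
  assert (0 <= k * k * (y ^ 2) ^ 2) by (apply Rmult_le_pos; nra).
  nra.
Qed.

Lemma dissipation1_density_le (alpha beta : R) :
  exists M : R, 0 < M /\ forall r p q,
    dissipation1_density alpha beta r p q <= M * dissipation2_density alpha beta r p q.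
Proof.
  set (A := (alpha - 1) ^ 2). set (B := (alpha - 2) ^ 2).
  assert (hA : 0 <= A) by apply pow2_ge_0.
  assert (hB : 0 <= B) by apply pow2_ge_0.
  (* Comes from [(z + (alpha-2) y^2)^2 <= 2 z^2 + 2 B y^4]; the final [1] keeps the constant
     positive when [alpha = 1], where [A = 0]. *)
  exists (2 * A * (1 + B) + A ^ 2 + 1). split; [nra |].
  intros r p q. unfold dissipation1_density, dissipation2_density.
  assert (0 < Rpower r (alpha + beta)) by apply exp_pos.
  set (z := q / r). set (y := p / r).
  replace ((alpha - 1) ^ 4) with (A ^ 2) by (unfold A; ring). fold A.
  enough (A * (z + (alpha - 2) * y ^ 2) ^ 2 + A ^ 2 * y ^ 4
          <= (2 * A * (1 + B) + A ^ 2 + 1) * (z ^ 2 + y ^ 4)) by nra.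
  assert (h1 : (z + (alpha - 2) * y ^ 2) ^ 2 <= 2 * z ^ 2 + 2 * B * y ^ 4).
  { pose proof (pow2_ge_0 (z - (alpha - 2) * y ^ 2)). unfold B. lra. }
  apply (Rmult_le_compat_l A _ _ hA) in h1.
  assert (hz : 0 <= z ^ 2) by apply pow2_ge_0.
  assert (hy : 0 <= y ^ 4) by (replace (y ^ 4) with ((y ^ 2) ^ 2) by ring; apply pow2_ge_0).
  assert (0 <= A * B * z ^ 2) by (apply Rmult_le_pos, hz; apply Rmult_le_pos; auto).
  assert (0 <= A * y ^ 4) by (apply Rmult_le_pos; auto).
  assert (0 <= A ^ 2 * z ^ 2) by (apply Rmult_le_pos; [apply pow2_ge_0 | auto]).
  nra.
Qed.

Lemma entropy_production_nonneg (a b alpha beta r p q : R) :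
  0 <= K a b alpha beta -> 0 <= entropy_production a b alpha beta r p q.
Proof.
  intros hK. unfold entropy_production.
  apply Rmult_le_pos; [apply Rlt_le, exp_pos |].
  apply Rplus_le_le_0_compat; [apply pow2_ge_0 |].
  apply Rmult_le_pos; [lra |].
  replace ((p / r) ^ 4) with (((p / r) ^ 2) ^ 2) by ring. apply pow2_ge_0.
Qed.

Theorem theorem2 (a b alpha beta : R) (hbeta : 0 <= beta) (halpha : 0 <= alpha) :
  (0 <= K a b alpha beta ->
    forall u : R -> R -> R, smooth_positive_solution a b beta u ->
    forall t : R, 0 < t ->
      ex_derive (entropy alpha u) t /\ Derive (entropy alpha u) t <= 0)
  /\
  (0 < K a b alpha beta ->
    (exists c : R, 0 < c /\
      forall u : R -> R -> R, smooth_positive_solution a b beta u ->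
      forall t : R, 0 < t ->
        ex_derive (entropy alpha u) t /\
        Derive (entropy alpha u) t + c * dissipation1 alpha beta u t <= 0)
    /\
    (exists c' : R, 0 < c' /\
      forall u : R -> R -> R, smooth_positive_solution a b beta u ->
      forall t : R, 0 < t ->
        ex_derive (entropy alpha u) t /\
        Derive (entropy alpha u) t + c' * dissipation2 alpha beta u t <= 0)).
Proof.
  split.
  - intros hK u sol t ht.
    (* With zero constant and zero dissipation the pointwise bound is just nonnegativity of the
       production. *)
    destruct (entropy_dissipation (alpha := alpha) sol 0 t (fun _ => 0) ht) as [h1 h2].
    + intros x. apply continuous_const.
    + intros x. rewrite Rmult_0_l. apply entropy_production_nonneg, hK.
    + split; [exact h1 | lra].
  - intros hK. destruct (dissipation2_density_le a b alpha beta hK) as (c & hc & hle).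
    destruct (dissipation1_density_le alpha beta) as (M & hM & hle1).
    split.
    (* The first density is at most [M] times the second, and [c] times the second is at most the
       production. *)
    + exists (c / M). split; [apply Rdiv_lt_0_compat; assumption |].
      intros u sol t ht. rewrite (dissipation1E a b) by assumption.
      destruct (ex_derive_dx_iter sol t ht) as (h0 & h1 & h2 & _).
      apply (entropy_dissipation sol); [exact ht | |].
      * intros x. pose proof (sol_positive _ _ _ _ sol x t ht).
        apply (ex_derive_continuous (V := R_NormedModule)).
        unfold dissipation1_density, Rpower. auto_derive. repeat split; auto; lra.
      * intros x. eapply Rle_trans; [| apply hle].
        unfold Rdiv. rewrite Rmult_assoc. apply Rmult_le_compat_l; [lra |].
        apply (Rmult_le_reg_l _ _ _ hM).
        rewrite <- Rmult_assoc, Rinv_r, Rmult_1_l by lra. apply hle1.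
    + exists c. split; [exact hc |].
      intros u sol t ht. rewrite (dissipation2E a b) by assumption.
      destruct (ex_derive_dx_iter sol t ht) as (h0 & h1 & h2 & _).
      apply (entropy_dissipation sol); [exact ht | |].
      * intros x. pose proof (sol_positive _ _ _ _ sol x t ht).
        apply (ex_derive_continuous (V := R_NormedModule)).
        unfold dissipation2_density, Rpower. auto_derive. repeat split; auto; lra.
      * intros x. apply hle.
Qed.
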